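(* Let $X$ be a metric space with metric $d$, $T$ a metrically nonspreading mapping of $X$ into itself, and $\{x_n\}$ a sequence in $X$ such that $\mathcal{A}(\{x_n\})=\{p\}$ for some $p\in X$ and $d(Tx_n,x_n)\to 0$ as $n\to\infty$. Then $p$ is an element of $\mathcal{F}(T)$.
   Context: $\mathcal{F}(T)=\{u\in X : Tu=u\}$ denotes the set of all fixed points of $T$. A mapping $T$ of a metric space $(X,d)$ into itself is metrically nonspreading if $2d(Tx,Ty)^2 \leq d(Tx,y)^2 + d(Ty,x)^2$ for all $x,y\in X$. The asymptotic center of a sequence $\{x_n\}$ in $X$ is $\mathcal{A}(\{x_n\})=\{u\in X : \limsup_n d(u,x_n)=\inf_{y\in X}\limsup_n d(y,x_n)\}$, where upper limits are taken in $[0,\infty]$ (so it is the whole space $X$ if $\{x_n\}$ is unbounded). *)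

(* Defs.v *)
From mathcomp Require Import all_boot all_order all_algebra.
From mathcomp Require Import all_classical all_reals all_analysis.

Set Implicit Arguments.
Unset Strict Implicit.
Unset Printing Implicit Defensive.

Import Order.TTheory GRing.Theory Num.Theory.
Import numFieldNormedType.Exports.

Local Open Scope classical_set_scope.
Local Open Scope ring_scope.

Definition fixed_points (X : Type) (T : X -> X) : set X := [set u | T u = u].

Definition metrically_nonspreading (R : realType) (X : metricType R)
    (T : X -> X) : Prop :=
  forall x y : X,
    2 * mdist (T x) (T y) ^+ 2 <= mdist (T x) y ^+ 2 + mdist (T y) x ^+ 2.

(* The upper limit is extended-real valued: it is +oo for unbounded x. *)
Definition limsup_dist (R : realType) (X : metricType R) (x : nat -> X)
    (y : X) : \bar R :=
  limn_esup (fun n => (mdist y (x n))%:E).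

Definition asymptotic_center (R : realType) (X : metricType R)
    (x : nat -> X) : set X :=
  [set u | limsup_dist x u = ereal_inf [set limsup_dist x y | y in [set: X]]].

(* Main.v *)
Require Import Defs.
From mathcomp Require Import all_boot all_order all_algebra.
From mathcomp Require Import all_classical all_reals all_analysis.
From mathcomp Require Import lra.

Import Order.TTheory GRing.Theory Num.Theory.
Import numFieldNormedType.Exports.

Local Open Scope classical_set_scope.
Local Open Scope ring_scope.

(** Applying [T] to [p] does not increase the upper limit of the distances to
    the sequence, so [T p] is again an asymptotic center and equals [p] by
    uniqueness.

    The increase is controlled pointwise: for all points [y] and [z],
    [d(Ty, z) <= d(y, z) + 5 d(Tz, z)] ([mdist_nonspreading_le]).  With
    [y = p] and [z = x_n] the error term tends to 0 and disappears in the upper limit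
    ([le_limf_esup_cvg0]).  Because the error is additive and does not involve
    the size of [d(p, x_n)], bounded and unbounded sequences are treated
    alike. *)

(** The pointwise bound passes to extended-real upper limits because the error
    is eventually below any given [eps]; intersecting each set of the filter
    with the set where this happens costs at most [eps] in the supremum. *)
Lemma le_limf_esup_cvg0 (R : realType) (Y : choiceType)
    (I : filteredType Y) (F : set_system I) (FF : Filter F) (u v e : I -> R) :
  (forall i, u i <= v i + e i) ->
  e @ F --> (0 : R) ->
  (limf_esup (EFin \o u) F <= limf_esup (EFin \o v) F)%E.
Proof.
move=> uve e0; apply/lee_addgt0Pr => eps eps0.
rewrite -leeBlDr//; apply: le_ereal_inf_tmp => _ [V FV <-].
rewrite leeBlDr//.
have Feps : F [set i | e i < eps] by exact: (cvgr_lt 0 e0).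
apply: (@le_trans _ _
  (ereal_sup ((EFin \o u) @` (V `&` [set i | e i < eps])))).
  apply: ereal_inf_lbound; exists (V `&` [set i | e i < eps]) => //.
  exact: filterI.
apply: ge_ereal_sup => _ [i [Vi /= ei] <-].
apply: (@le_trans _ _ ((v i)%:E + eps%:E)%E).
  by rewrite -EFinD lee_fin (le_trans (uve i))// lerD2l ltW.
by rewrite leeD2r//; apply: ereal_sup_ubound; exists i.
Qed.

(** With [a = d(y, z)], [b = d(Ty, z)], [c = d(Ty, Tz)] and [e = d(Tz, z)], the
    triangle inequality turns the nonspreading inequality into
    [2 c^2 <= (c + e)^2 + (a + e)^2].  Completing the square,
    [(c - e)^2 <= (a + e)^2 + 2 e^2 <= (a + 3 e)^2], so [c <= a + 4 e], and
    [b <= c + e]. *)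
Lemma mdist_nonspreading_le (R : realType) (X : metricType R) (T : X -> X)
    (y z : X) :
  metrically_nonspreading T ->
  mdist (T y) z <= mdist y z + 5 * mdist (T z) z.
Proof.
move=> /(_ y z); have := metric_triangle (T y) (T z) z.
have := metric_triangle (T z) z y; rewrite (metric_sym z y).
move: (mdist_ge0 (T y) z) (mdist_ge0 y z) (mdist_ge0 (T z) z).
move: (mdist_ge0 (T y) (T z)) (mdist_ge0 (T z) y).
set a := mdist y z; set b := mdist (T y) z; set c := mdist (T y) (T z).
set e := mdist (T z) z; set f := mdist (T z) y.
move=> c0 f0 b0 a0 e0 fle ble nonspr.
have b2 : b ^+ 2 <= (c + e) ^+ 2 by rewrite lerXn2r// nnegrE addr_ge0.
have f2 : f ^+ 2 <= (a + e) ^+ 2.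
  by rewrite lerXn2r// ?nnegrE ?addr_ge0// addrC.
have ce2 : (c - e) ^+ 2 <= (a + 3 * e) ^+ 2.
  have ae0 : 0 <= a * e by rewrite mulr_ge0.
  have ee0 : 0 <= e * e by rewrite mulr_ge0.
  by nra.
have ce : c - e <= a + 3 * e.
  rewrite (le_trans (ler_norm _))//.
  by rewrite -ler_sqr ?nnegrE ?normr_ge0 ?real_normK ?num_real//; lra.
by lra.
Qed.

Theorem theorem4p5 (R : realType) (X : metricType R) (T : X -> X)
    (x : nat -> X) (p : X) :
  metrically_nonspreading T ->
  asymptotic_center x = [set p] ->
  (fun n : nat => mdist (T (x n)) (x n)) @ \oo --> (0 : R) ->
  fixed_points T p.
Proof.
move=> Tns Ap Tx0.
have pmin : asymptotic_center x p by rewrite Ap.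
have Tp_le : (limsup_dist x (T p) <= limsup_dist x p)%E.
  apply: (@le_limf_esup_cvg0 _ _ nat \oo _ (fun n => mdist (T p) (x n))
    (fun n => mdist p (x n)) (fun n => 5 * mdist (T (x n)) (x n))).
    by move=> n; exact: mdist_nonspreading_le.
  by rewrite -(mulr0 5); exact: cvgMr.
suff : asymptotic_center x (T p) by rewrite Ap.
apply/eqP; rewrite eq_le; apply/andP; split; first by rewrite -pmin.
by apply: ereal_inf_lbound; exists (T p).
Qed.
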